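(* Let $m,n\ge1$ be integers and let $W=S_{m+n}\oplus S_{m+n-2}$. The morphism $$\sigma:\mathbf P S_m\times\mathbf P S_n\longrightarrow\mathbf P W,\qquad (A,B)\longmapsto[(A,B)_0,\,(A,B)_1]=[AB,\,(A,B)_1]$$ is an imbedding of algebraic varieties (i.e. a closed immersion).
   Context: Work over a field $\Bbbk$ of characteristic zero. $S_d$ is the $\Bbbk$-vector space of binary forms of order (degree) $d$ in $x_1,x_2$, and $\mathbf P W$ is the projective space of lines in $W$. For binary forms $A,B$ of orders $m,n$, $(A,B)_0=AB$ and $(A,B)_1$ is the first transvectant $$(A,B)_1=\frac1{mn}\left(\frac{\partial A}{\partial x_1}\frac{\partial B}{\partial x_2}-\frac{\partial A}{\partial x_2}\frac{\partial B}{\partial x_1}\right),$$ a binary form of order $m+n-2$. *)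

(* Defs.v *)
From HB Require Import structures.
From mathcomp Require Import all_boot all_order all_algebra.
From mathcomp Require Import zify ring mpoly.
From mathcomp Require Import boolp classical_sets topology_structure.

Set Implicit Arguments.
Unset Strict Implicit.
Unset Printing Implicit Defensive.

Import GRing.Theory.
Local Open Scope classical_set_scope.
Local Open Scope ring_scope.

(* Varieties are schemes over an arbitrary field k, as in EGA / Hartshorne II:
   the points of a (multi)projective space are the (multi)homogeneous relevant
   prime ideals of its coordinate ring, with the Zariski topology and the
   sheaf of functions that are locally quotients of forms of equal degree. *)

Section Multiprojective.
Context (k : fieldType) (N r : nat) (g : 'I_N -> 'I_r).

(* The variables 'X_i with g i = j are the homogeneous coordinates on the
   j-th of r projective spaces; gdeg j is the degree in those variables. *)
Definition gdeg (j : 'I_r) (m : 'X_{1..N}) : nat :=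
  (\sum_(i < N | g i == j) m i)%N.

Fact gdeg0 j : gdeg j 0%MM = 0%N.
Proof. by rewrite /gdeg big1 // => i _; rewrite mnm0E. Qed.

Fact gdegD j : {morph gdeg j : m1 m2 / (m1 + m2)%MM >-> (m1 + m2)%N}.
Proof.
by move=> m1 m2; rewrite /gdeg -big_split /=; apply: eq_bigr => i _; rewrite mnmDE.
Qed.

HB.instance Definition _ (j : 'I_r) :=
  isMeasure.Build N (gdeg j) (gdeg0 j) (gdegD j).

Definition multihomog (d : 'I_r -> nat) (F : {mpoly k[N]}) : Prop :=
  forall j, F \is (d j).-homog for (gdeg j).

Record mproj := MProj {
  mproj_ideal : {mpoly k[N]} -> bool;
  mproj_idealP : idealr_closed mproj_ideal;
  mproj_primeP : prime_idealr_closed mproj_ideal;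
  mproj_homogP : forall (j : 'I_r) (d : nat) (F : {mpoly k[N]}),
    F \in mproj_ideal -> pihomog (gdeg j) d F \in mproj_ideal;
  mproj_relevantP : forall j : 'I_r,
    exists2 i : 'I_N, g i = j & 'X_i \notin mproj_ideal }.

Definition mproj_pred (p : mproj) : {pred {mpoly k[N]}} := mproj_ideal p.
Coercion mproj_pred : mproj >-> pred_sort.

HB.instance Definition _ := gen_eqMixin mproj.
HB.instance Definition _ := gen_choiceMixin mproj.

Definition zero_locus (E : set {mpoly k[N]}) : set mproj :=
  [set p : mproj | forall F, E F -> F \in p].

Definition zariski_open (U : set mproj) : Prop :=
  exists2 E : set {mpoly k[N]},
    (forall F, E F -> exists d, multihomog d F) & U = (~` zero_locus E)%classic.

Fact zariski_openT : zariski_open setT.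
Proof.
exists [set F | F = 1].
  move=> _ ->; exists (fun=> 0%N) => j; exact: dhomog1.
apply/esym; rewrite -subTset => p _ /(_ 1 erefl).
by case: (mproj_idealP p) => _ /negP.
Qed.

Fact zariski_openI : setI_closed zariski_open.
Proof.
move=> _ _ [E1 h1 ->] [E2 h2 ->].
exists [set H | exists F G, [/\ E1 F, E2 G & H = F * G]].
  move=> _ [F [G [/h1[d1 hF] /h2[d2 hG] ->]]].
  by exists (fun j => d1 j + d2 j)%N => j; apply: dhomogM.
apply/seteqP; split => p.
  move=> [n1 n2] n12.
  have [F EF Fp] : exists2 F, E1 F & F \notin (p : {pred _}).
    apply: contrapT => h; apply: n1 => F EF; apply: contrapT => /negP nF.
    by apply: h; exists F.
  have [G EG Gp] : exists2 G, E2 G & G \notin (p : {pred _}).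
    apply: contrapT => h; apply: n2 => G EG; apply: contrapT => /negP nG.
    by apply: h; exists G.
  have /(mproj_primeP (m := p)) : F * G \in (p : {pred _}).
    by apply: n12; exists F, G.
  by rewrite (negPf Fp) (negPf Gp).
have idM a b : b \in (p : {pred _}) -> a * b \in (p : {pred _}).
  by move=> ?; case: (idealr_closed_nontrivial (mproj_idealP p)) => _; apply.
move=> n12; split => n; apply: n12 => _ [F [G [EF EG ->]]].
  by rewrite mulrC; apply/idM/n.
exact/idM/n.
Qed.

Fact zariski_open_bigU (I : Type) (f : I -> set mproj) :
  (forall i, zariski_open (f i)) -> zariski_open (\bigcup_i f i)%classic.
Proof.
move=> /(_ _)/cid2 h.
pose E i := projT1 (h i).
have hE i F : E i F -> exists d, multihomog d F by rewrite /E; case: (h i) => /= ? + _; apply.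
have fE i : f i = (~` zero_locus (E i))%classic by rewrite /E; case: (h i).
exists [set F | exists i, E i F]; first by move=> F [i /hE].
apply/seteqP; split => p.
  move=> [i _]; rewrite fE => n n'; apply: n => F EF; apply: n'; by exists i.
move=> n; apply: contrapT => n'; apply: n => F [i EF].
apply: contrapT => nF; apply: n'; exists i => //; rewrite fE => hp.
by apply: nF; apply: hp.
Qed.

HB.instance Definition _ := isOpenTopological.Build mproj
  zariski_openT zariski_openI zariski_open_bigU.

(* F / G in the fraction field of the coordinate ring.  As that ring is a
   domain, the local ring at p (the degree 0 part of the homogeneous
   localization at p) is the subring of those frac F G with F and G
   multihomogeneous of the same degree and G \notin p. *)
Definition frac (F G : {mpoly k[N]}) : {fraction {mpoly k[N]}} :=
  @FracField.tofrac _ F / @FracField.tofrac _ G.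

(* s is a section over U of the structure sheaf; the values of s outside U are
   irrelevant. *)
Definition regular (U : set mproj) (s : mproj -> {fraction {mpoly k[N]}}) :=
  forall p : mproj, U p -> exists V : set mproj,
    [/\ open V, V p, (V `<=` U)%classic
      & exists d F G, [/\ multihomog d F, multihomog d G
        & forall q : mproj, V q -> G \notin q /\ s q = frac F G]].

End Multiprojective.

Arguments multihomog {k N r} g d F.
Arguments regular {k N r} g U s.

Section ProjectiveSpace.
Context (k : fieldType) (M : nat).

Definition onegroup : 'I_M -> 'I_1 := fun=> ord0.

(* Projective space with homogeneous coordinates 'X_0, ..., 'X_(M-1). *)
Definition proj := mproj k onegroup.

Lemma gdeg_onegroup j m : gdeg onegroup j m = mdeg m.
Proof.
rewrite mdegE /gdeg; apply: eq_bigl => i; by rewrite (ord1 j).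
Qed.

End ProjectiveSpace.

HB.instance Definition _ (k : fieldType) (M : nat) := Topological.on (proj k M).

Section Morphism.
Context (k : fieldType) (N r : nat) (g : 'I_N -> 'I_r) (M : nat).

(* The morphism from a multiprojective space to projective (M-1)-space given by
   M forms of the same multidegree without common zero.  A constant map is
   also given by forms of multidegree 0, excluded here so that the preimage
   of a homogeneous ideal by substitution is homogeneous. *)
Record morphism := Morphism {
  mor_forms :> M.-tuple {mpoly k[N]};
  mor_deg : 'I_r -> nat;
  mor_deg_neq0 : exists j, (0 < mor_deg j)%N;
  mor_homogP : forall i, multihomog g mor_deg (tnth mor_forms i);
  mor_basefree : forall p : mproj k g, exists i, tnth mor_forms i \notin p }.

Variable f : morphism.

Definition pullback (h : {mpoly k[M]}) : {mpoly k[N]} := h \mPo f.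

Lemma pullback_pihomog j (j0 : 'I_1) d h :
  (0 < mor_deg f j)%N ->
  pullback (pihomog (gdeg (@onegroup M) j0) d h) =
  pihomog (gdeg g j) (d * mor_deg f j) (pullback h).
Proof.
move=> e0; rewrite /pullback [h in LHS]mpolyE [h in RHS]mpolyE.
rewrite (linear_sum (pihomog (gdeg (@onegroup M) j0) d)) !(linear_sum (comp_mpoly f)).
rewrite (linear_sum (pihomog (gdeg g j) (d * mor_deg f j))) /=.
apply: eq_bigr => m _.
rewrite !linearZ /=; congr (_ *: _).
rewrite pihomogX /= gdeg_onegroup !comp_mpolyX.
have hX : \prod_(i < M) tnth f i ^+ m i \is (mdeg m * mor_deg f j).-homog for (gdeg g j).
  rewrite mdegE big_distrl /=.
  elim/big_ind2: _ => [|x d1 y d2|i _]; first exact: dhomog1.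
  - exact: dhomogM.
  - by rewrite mulnC; apply: dhomogMn; apply: mor_homogP.
case: eqVneq => [<-|ne]; first by rewrite comp_mpolyX (pihomog_dE hX).
rewrite raddf0; apply/esym/(pihomog_ne0 _ hX).
by rewrite eqn_pmul2r.
Qed.

Section Point.
Variable p : mproj k g.

Definition mor_ideal : {pred {mpoly k[M]}} := [pred h | pullback h \in p].

Fact mor_idealP : idealr_closed mor_ideal.
Proof.
case: (mproj_idealP p) => p0 p1 pD; split; rewrite ?inE /pullback ?raddf0 //.
  by rewrite rmorph1.
by move=> a u v; rewrite !inE /pullback rmorphD rmorphM; apply: pD.
Qed.

Fact mor_primeP : prime_idealr_closed mor_ideal.
Proof. by move=> u v; rewrite !inE /pullback rmorphM; apply: mproj_primeP. Qed.

Fact mor_ideal_homog (j : 'I_1) d h :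
  h \in mor_ideal -> pihomog (gdeg (@onegroup M) j) d h \in mor_ideal.
Proof.
have [j0 hj0] := mor_deg_neq0 f; rewrite !inE (pullback_pihomog _ _ _ hj0).
exact: mproj_homogP.
Qed.

Fact mor_ideal_relevant (j : 'I_1) :
  exists2 i, @onegroup M i = j & 'X_i \notin mor_ideal.
Proof.
have [i hi] := mor_basefree f p; exists i; first by rewrite [j]ord1.
by rewrite inE /pullback comp_mpolyXU -tnth_nth.
Qed.

Definition mor_point : proj k M :=
  MProj mor_idealP mor_primeP mor_ideal_homog mor_ideal_relevant.

End Point.

(* t is the image of s under the comorphism O(V) -> O(f^-1(V)), which at a
   point p is the local homomorphism F / G |-> pullback F / pullback G. *)
Definition comorphism (V : set (proj k M))
    (s : proj k M -> {fraction {mpoly k[M]}})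
    (t : mproj k g -> {fraction {mpoly k[N]}}) : Prop :=
  forall p : mproj k g, V (mor_point p) -> exists d F G,
    [/\ multihomog (@onegroup M) d F, multihomog (@onegroup M) d G,
        G \notin mor_point p, s (mor_point p) = frac F G
      & t p = frac (pullback F) (pullback G)].

(* A homeomorphism onto a closed subset such that the map of sheaves from O to
   the direct image of O is surjective. *)
Definition closed_immersion : Prop :=
  [/\ injective mor_point,
      continuous mor_point,
      forall U : set (mproj k g), open U -> exists2 V : set (proj k M),
        open V & (mor_point @` U = range mor_point `&` V)%classic,
      closed (range mor_point)
    & forall (V : set (proj k M)) (t : mproj k g -> {fraction {mpoly k[N]}}),
        open V -> regular g (mor_point @^-1` V)%classic t ->
        forall y : proj k M, V y -> exists W : set (proj k M),
          [/\ open W, W y, (W `<=` V)%classic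
            & exists2 s, regular (@onegroup M) W s & comorphism W s t]].

End Morphism.

Arguments closed_immersion {k N r g M} f.

Section BinaryForms.

Definition bmon (d i : nat) : 'X_{1..2} :=
  (U_(0%R : 'I_2) *+ (d - i) + U_(1%R : 'I_2) *+ i)%MM.

(* Binary forms of order d, with x_1 = 'X_0 and x_2 = 'X_1; the coordinates on
   S_d are the coefficients of the monomials x_1^(d-i) x_2^i, 0 <= i <= d. *)
Definition bform (R : comNzRingType) (d : nat) (a : 'I_d.+1 -> R) : {mpoly R[2]} :=
  \sum_(i < d.+1) a i *: 'X_[bmon d i].

Definition transvectant1 (R : comUnitRingType) (m n : nat)
    (A B : {mpoly R[2]}) : {mpoly R[2]} :=
  (m * n)%:R^-1 *: (A^`M(0) * B^`M(1) - A^`M(1) * B^`M(0)).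

Lemma bmonD m n i j : (i <= m)%N -> (j <= n)%N ->
  (bmon m i + bmon n j = bmon (m + n) (i + j))%MM.
Proof.
move=> im jn; apply/mnmP => l; rewrite !(mnmDE, mulmnE).
have -> : (m + n - (i + j) = (m - i) + (n - j))%N by lia.
by rewrite !mulnDr addnACA.
Qed.

Lemma bmon_inj d i j : bmon d i = bmon d j -> i = j.
Proof.
move/mnmP/(_ 1); rewrite !(mnmDE, mulmnE) !mnmE /= !mul0n !add0n !mul1n //.
Qed.

Definition tcoef (R : pzRingType) (m n i j : nat) (mu : 'X_{1..2}) : R :=
  let c (a b : 'I_2) := (bmon m i a * bmon n j b *
    ((bmon m i - U_(a) + (bmon n j - U_(b)))%MM == mu))%N in
  (c 0 1)%:R - (c 1 0)%:R.

Lemma mcoeff_transvectant1 (R : comUnitRingType) m n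
    (a : 'I_m.+1 -> R) (b : 'I_n.+1 -> R) mu :
  (transvectant1 m n (bform a) (bform b))@_mu =
  (m * n)%:R^-1 * \sum_(i < m.+1) \sum_(j < n.+1) tcoef R m n i j mu * (a i * b j).
Proof.
have dB (x y : 'I_2) : ((bform a)^`M(x) * (bform b)^`M(y))@_mu =
    \sum_(i < m.+1) \sum_(j < n.+1) (bmon m i x * bmon n j y *
    ((bmon m i - U_(x) + (bmon n j - U_(y)))%MM == mu))%N%:R * (a i * b j).
  rewrite /bform !raddf_sum /= big_distrlr /= raddf_sum.
  apply: eq_bigr => u _; rewrite raddf_sum; apply: eq_bigr => w _ /=.
  rewrite !mderivZ !mderivX !scalerA -scalerAl -scalerAr scalerA.
  rewrite -(mpolyXD _ (bmon m u - U_(x))) mcoeffZ mcoeffX !natrM.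
  ring.
rewrite /transvectant1 mcoeffZ mcoeffB !dB -sumrB; congr (_ * _).
apply: eq_bigr => u _; rewrite -sumrB; apply: eq_bigr => w _.
by rewrite /tcoef mulrBl.
Qed.

Lemma mcoeff_bformM (R : comNzRingType) m n
    (a : 'I_m.+1 -> R) (b : 'I_n.+1 -> R) (l : nat) :
  (bform a * bform b)@_(bmon (m + n) l) =
  \sum_(i < m.+1) \sum_(j < n.+1) ((i + j)%N == l)%:R * (a i * b j).
Proof.
rewrite /bform big_distrlr /= raddf_sum; apply: eq_bigr => i _.
rewrite raddf_sum; apply: eq_bigr => j _ /=.
rewrite -scalerAl -scalerAr scalerA -mpolyXD mcoeffZ mcoeffX mulrC.
rewrite (bmonD (ltnSE (ltn_ord i)) (ltnSE (ltn_ord j))).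
by rewrite (inj_eq (@bmon_inj (m + n))).
Qed.

(* Gauss's lemma modulo a prime ideal. *)
Lemma bform_content (R : comNzRingType) (p : {pred R}) m n
    (a : 'I_m.+1 -> R) (b : 'I_n.+1 -> R) :
  idealr_closed p -> prime_idealr_closed p ->
  (exists i, a i \notin p) -> (exists j, b j \notin p) ->
  exists l : 'I_(m + n).+1, (bform a * bform b)@_(bmon (m + n) l) \notin p.
Proof.
move=> [p0 _ pD] pP [ia hia] [ib hib].
have idM x y : y \in p -> x * y \in p.
  by move=> hy; rewrite -[_ * _]addr0; apply: pD.
have sumP (T : finType) (P : pred T) (F : T -> R) :
    (forall i, P i -> F i \in p) -> \sum_(i | P i) F i \in p.
  move=> hF; elim/big_ind: _ => // x y hx hy.
  by have := pD 1 x y hx hy; rewrite mul1r.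
case: (arg_minnP (P := fun i => a i \notin p) val hia) => i0 hi0 mini.
case: (arg_minnP (P := fun j => b j \notin p) val hib) => j0 hj0 minj.
have lt : (i0 + j0 < (m + n).+1)%N by have := ltn_ord i0; have := ltn_ord j0; lia.
exists (Ordinal lt); rewrite mcoeff_bformM /=.
apply/negP => h.
have /pP : a i0 * b j0 \in p; last by rewrite (negPf hi0) (negPf hj0).
have term (i : 'I_m.+1) (j : 'I_n.+1) : (i != i0) || (j != j0) ->
    ((i + j)%N == (i0 + j0)%N)%:R * (a i * b j) \in p.
  move=> ne; case: eqP => [e|_]; last by rewrite mul0r.
  apply: (idM); have [lti|gei] := ltnP i i0.
    rewrite mulrC; apply/idM; apply: contraLR lti => /mini; by rewrite -leqNgt.
  have ltj : (j < j0)%N by move: ne; rewrite -!val_eqE /=; lia.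
  by apply/idM; apply: contraLR ltj => /minj; rewrite -leqNgt.
move: h; rewrite (bigD1 i0) //= (bigD1 j0) //= eqxx mul1r -addrA.
set r := (X in _ + X) => h.
have hr : r \in p.
  rewrite /r -[X in X + _]mul1r; apply: (pD).
    by apply: (sumP) => j ne; apply: term; rewrite ne orbT.
  by apply: (sumP) => i ne; apply: (sumP) => j _; apply: term; rewrite ne.
by have := pD (-1) r _ hr h; rewrite mulN1r [_ * _ + r]addrC addKr.
Qed.

End BinaryForms.

Section Sigma.
Context (k : fieldType) (m n : nat).

(* Coordinates on S_m x S_n: the m+1 coefficients of A, then the n+1
   coefficients of B. *)
Definition two_groups (v : 'I_(m.+1 + n.+1)) : 'I_2 :=
  match split v with inl _ => 0 | inr _ => 1 end.

Local Notation S := {mpoly k[m.+1 + n.+1]}.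

Definition genericA : {mpoly S[2]} := bform (fun i : 'I_m.+1 => 'X_(lshift n.+1 i)).
Definition genericB : {mpoly S[2]} := bform (fun j : 'I_n.+1 => 'X_(rshift m.+1 j)).

(* Coordinates on W: the m+n+1 coefficients of the component in S_(m+n), then
   the m+n-1 coefficients of the component in S_(m+n-2). *)
Definition sigma_form (v : 'I_((m + n).+1 + (m + n - 2).+1)) : S :=
  match split v with
  | inl i => (genericA * genericB)@_(bmon (m + n) i)
  | inr i => (transvectant1 m n genericA genericB)@_(bmon (m + n - 2) i)
  end.

Lemma two_groups_l i : two_groups (lshift n.+1 i) = 0.
Proof. by rewrite /two_groups (unsplitK (inl i)). Qed.

Lemma two_groups_r j : two_groups (rshift m.+1 j) = 1.
Proof. by rewrite /two_groups (unsplitK (inr j)). Qed.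

Lemma bihomogXX i j :
  multihomog two_groups (fun=> 1%N) ('X_(lshift n.+1 i) * 'X_(rshift m.+1 j) : S).
Proof.
move=> l; rewrite -mpolyXD dhomogX /= gdegD.
have gU a : gdeg two_groups l U_(a)%MM = (two_groups a == l).
  rewrite /gdeg big_mkcond (bigD1 a) //= mnm1E eqxx big1 ?addn0; first by case: ifP.
  by move=> b ne; rewrite mnm1E [a == b]eq_sym (negPf ne) if_same.
rewrite !gU two_groups_l two_groups_r.
by case: l {gU} => -[|[|]].
Qed.

Lemma natV_MP (N : nat) : (N%:R : S)^-1 = ((N%:R : k)^-1)%:MP.
Proof.
rewrite -[N%:R in LHS](rmorph_nat (@mpolyC _ k)).
have [->|nz] := eqVneq (N%:R : k) 0; first by rewrite !(invr0, rmorph0).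
by rewrite rmorphV // unitfE.
Qed.

Lemma bihomog_bilin (c : 'I_m.+1 -> 'I_n.+1 -> k) :
  multihomog two_groups (fun=> 1%N)
    (\sum_(i < m.+1) \sum_(j < n.+1)
      ((c i j)%:MP : S) * ('X_(lshift n.+1 i) * 'X_(rshift m.+1 j))).
Proof.
move=> l; apply: rpred_sum => i _; apply: rpred_sum => j _.
by rewrite mul_mpolyC; apply: rpredZ; apply: bihomogXX.
Qed.

Lemma sigma_form_homog v : multihomog two_groups (fun=> 1%N) (sigma_form v).
Proof.
rewrite /sigma_form; case: split => i.
  rewrite mcoeff_bformM.
  under eq_bigr => u _ do under eq_bigr => w _ do
    rewrite -[_%:R](rmorph_nat (@mpolyC _ k)).
  exact: bihomog_bilin.
rewrite mcoeff_transvectant1 natV_MP mul_mpolyC => l; apply: rpredZ; move: l.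
under eq_bigr => u _ do under eq_bigr => w _ do
  rewrite /tcoef -!(rmorph_nat (@mpolyC _ k)) -rmorphB.
exact: bihomog_bilin.
Qed.

Lemma sigma_form_basefree (p : mproj k two_groups) :
  exists v, sigma_form v \notin (p : {pred S}).
Proof.
have [ia ga hia] := mproj_relevantP p 0; have [ib gb hib] := mproj_relevantP p 1.
have ha : exists i : 'I_m.+1, 'X_(lshift n.+1 i) \notin (p : {pred S}).
  move: ga hia; rewrite -[ia]splitK; case: split => [i|i] /= ga hia; first by exists i.
  by move: ga; rewrite two_groups_r.
have hb : exists j : 'I_n.+1, 'X_(rshift m.+1 j) \notin (p : {pred S}).
  move: gb hib; rewrite -[ib]splitK; case: split => [i|i] /= gb hib; last by exists i.
  by move: gb; rewrite two_groups_l.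
have [l hl] := bform_content (mproj_idealP p) (mproj_primeP (m := p)) ha hb.
by exists (lshift _ l); rewrite /sigma_form (unsplitK (inl _)).
Qed.
Fact sigma_deg_neq0 : exists j : 'I_2, (0 < (fun=> 1%N) j)%N.
Proof. by exists 0. Qed.

Fact sigma_homog v : multihomog two_groups (fun=> 1%N) (tnth (mktuple sigma_form) v).
Proof. by rewrite tnth_mktuple; apply: sigma_form_homog. Qed.

Fact sigma_basefree (p : mproj k two_groups) :
  exists v, tnth (mktuple sigma_form) v \notin p.
Proof.
by have [v hv] := sigma_form_basefree p; exists v; rewrite tnth_mktuple.
Qed.

Definition sigma : morphism k two_groups ((m + n).+1 + (m + n - 2).+1) :=
  Morphism sigma_deg_neq0 sigma_homog sigma_basefree.

End Sigma.

(* Main.v *)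
(* In the affine coordinate x = x_2/x_1 let P = ab and Q = a'b.  The coefficients
   of P and of Q are linear in the coordinates of (AB, (A,B)_1), because
   m P' - m n J = (m + n) Q when J is the transvectant.  Since Q/P = a'/a is the
   logarithmic derivative, a^(j)/a = R_j(P,Q)/P^j for universal differential
   polynomials R_j, and descending on the coefficients of a (using 1/j!) shows
   that a divides a_i P^m inside the image of the comorphism, and likewise for
   b; hence a_i b_j P^(m+n) has its coefficients in the image.  These
   coefficients of P^(m+n) have no common zero: R_(m+1) = 0 because the derivative
   a^(m+1) is 0, while R_(m+1) is congruent to Q^(m+1) modulo P and P', so that
   Q, and with it every coordinate, would vanish together with P.  So locally
   every bihomogeneous function comes from W, and a point of W on which the
   relations hold is recovered by (a_i) = (a_i b_(j0)), (b_j) = (a_(i0) b_j). *)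
Require Import Defs.
From HB Require Import structures.
From mathcomp Require Import all_boot all_order all_algebra.
From mathcomp Require Import zify ring mpoly.
From mathcomp Require Import boolp classical_sets topology_structure.

Set Implicit Arguments.
Unset Strict Implicit.
Unset Printing Implicit Defensive.

Import GRing.Theory.
Local Open Scope classical_set_scope.
Local Open Scope ring_scope.

(** * Iterated logarithmic derivatives *)

Section LogDerivative.
Variables (R : comNzRingType).
Implicit Types a b P Q : {poly R}.

(** The recursion is the quotient rule: if a'/a = Q/P and a^(j)/a = R_j/P^j, then a^(j+1)/a =
    (R_j/P^j)' + (R_j/P^j)(Q/P), written over P^(j+1). *)
Fixpoint logder P Q (j : nat) : {poly R} :=
  if j is i.+1 then P * (logder P Q i)^`() + Q * logder P Q i - (P^`() * logder P Q i) *+ i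
  else 1.

Lemma logderE a P Q j : a^`() * P = Q * a ->
  logder P Q j * a = a^`(j) * P ^+ j.
Proof.
move=> aP; elim: j => [|j IH]; first by rewrite mul1r mulr1.
(* The extra factor P avoids the exponent j - 1, which truncates at j = 0. *)
have dP : P * (P ^+ j)^`() = (P^`() * P ^+ j) *+ j.
  by case: (j) => [|i]; rewrite ?derivC ?mulr0 // deriv_exp exprS /=; ring.
rewrite derivnS [logder _ _ _]/= exprS; set r := logder P Q j in IH *.
have IH' : r^`() * a + r * a^`() = a^`(j)^`() * P ^+ j + a^`(j) * (P ^+ j)^`().
  by rewrite -!derivM IH.
(* Both sides are rearranged to expose [IH], its derivative [IH'], [aP] and [dP]. *)
have -> : (P * r^`() + Q * r - P^`() * r *+ j) * a =
    P * (r^`() * a + r * a^`()) + r * (Q * a - a^`() * P) - P^`() * (r * a) *+ j.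
  by ring.
have -> : a^`(j)^`() * (P * P ^+ j) =
    P * (a^`(j)^`() * P ^+ j + a^`(j) * (P ^+ j)^`()) - a^`(j) * (P * (P ^+ j)^`()).
  by ring.
by rewrite IH' IH aP dP; ring.
Qed.

End LogDerivative.

(** R_j is a differential polynomial with integer coefficients, so it can be formed from the
    coordinates of W and evaluated after pullback. *)
Lemma map_logder (R' R : comNzRingType) (f : {rmorphism R' -> R}) (p q : {poly R'}) j :
  map_poly f (logder p q j) = logder (map_poly f p) (map_poly f q) j.
Proof.
elim: j => [|j IH]; first exact: rmorph1.
by rewrite /= rmorphB rmorphD rmorphMn !rmorphM /= -!deriv_map IH.
Qed.

(** * Binary forms dehomogenized at x_1 = 1 *)

Definition ord_poly (R : nzRingType) d (c : 'I_d.+1 -> R) : {poly R} :=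
  \sum_(i < d.+1) c i *: 'X^i.

Section OrdPoly.
Variables (R : comNzRingType) (d : nat) (c : 'I_d.+1 -> R).

Lemma coef_ord_poly (i : 'I_d.+1) : (ord_poly c)`_i = c i.
Proof.
rewrite coef_sum (bigD1 i) //= coefZ coefXn eqxx mulr1 big1 ?addr0 // => j ne.
by rewrite coefZ coefXn eq_sym (inj_eq val_inj) (negPf ne) mulr0.
Qed.

Lemma size_ord_poly : (size (ord_poly c) <= d.+1)%N.
Proof.
apply: (leq_trans (size_sum _ _ _)); apply/bigmax_leqP => i _.
by apply: (leq_trans (size_scale_leq _ _)); rewrite size_polyXn ltn_ord.
Qed.

Lemma derivn_ord_poly j : (ord_poly c)^`(j) = \sum_(i < d.+1) (c i *: 'X^(i - j)) *+ i ^_ j.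
Proof.
rewrite /ord_poly raddf_sum; apply: eq_bigr => i _ /=.
by rewrite derivnZ derivnXn scalerMnr.
Qed.

End OrdPoly.

Lemma ord_polyM (R : comNzRingType) d e (a : 'I_d.+1 -> R) (b : 'I_e.+1 -> R) :
  ord_poly a * ord_poly b = \sum_(i < d.+1) \sum_(j < e.+1) (a i * b j) *: 'X^(i + j).
Proof.
rewrite /ord_poly big_distrlr; apply: eq_bigr => i _; apply: eq_bigr => j _ /=.
by rewrite -scalerAl -scalerAr scalerA exprD.
Qed.

Lemma ord_poly_map (R R' : nzRingType) (f : {rmorphism R -> R'}) d (c : 'I_d.+1 -> R) :
  map_poly f (ord_poly c) = ord_poly (f \o c).
Proof.
rewrite /ord_poly rmorph_sum; apply: eq_bigr => i _.
by rewrite /= map_polyZ map_polyXn.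
Qed.

Lemma coef_ord_poly_gt (R : comNzRingType) d (c : 'I_d.+1 -> R) l :
  (d < l)%N -> (ord_poly c)`_l = 0.
Proof. by move=> lt; apply/nth_default/(leq_trans (size_ord_poly c)). Qed.

Section OrdPolyDerivM.
Variables (R : comNzRingType) (d e : nat) (a : 'I_d.+1 -> R) (b : 'I_e.+1 -> R).

(** At i = j = 0 the exponent truncates harmlessly, because the coefficient is zero. *)
Lemma ord_poly_derivM : (ord_poly a)^`() * ord_poly b =
  \sum_(i < d.+1) \sum_(j < e.+1) (i%:R * (a i * b j)) *: 'X^((i + j).-1).
Proof.
rewrite -derivn1 derivn_ord_poly [ord_poly b]/ord_poly big_distrlr.
apply: eq_bigr => i _; apply: eq_bigr => j _ /=.
rewrite ffactn1; case: (i : nat) => [|i']; first by rewrite mulr0n !mul0r scale0r.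
rewrite subn1 addSn /= exprD -!mul_polyC !polyCM polyC_natr; ring.
Qed.

Lemma ord_polyM_deriv : ord_poly a * (ord_poly b)^`() =
  \sum_(i < d.+1) \sum_(j < e.+1) (j%:R * (a i * b j)) *: 'X^((i + j).-1).
Proof.
rewrite -derivn1 derivn_ord_poly [ord_poly a]/ord_poly big_distrlr.
apply: eq_bigr => i _; apply: eq_bigr => j _ /=.
rewrite ffactn1; case: (j : nat) => [|j']; first by rewrite mulr0n mulr0 !mul0r scale0r.
rewrite subn1 addnS /= exprD -!mul_polyC !polyCM polyC_natr; ring.
Qed.

End OrdPolyDerivM.

(* ord_poly c divides each c_i P^d over the image of f.  This is proved by descending
   induction on i, reading off i! c_i from the i-th derivative of ord_poly c. *)
Lemma coef_pow_dvd_image (T S : comUnitRingType) (f : {rmorphism T -> S})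
    (natu : forall i, (0 < i)%N -> i%:R \is a @GRing.unit T) d (c : 'I_d.+1 -> S)
    (b : {poly S}) (P Q : {poly T}) :
  map_poly f P = ord_poly c * b -> map_poly f Q = (ord_poly c)^`() * b ->
  forall i, exists U, c i *: (ord_poly c * b) ^+ d = map_poly f U * ord_poly c.
Proof.
move=> fP fQ.
pose good (r : {poly S}) := exists U, r * (ord_poly c * b) ^+ d = map_poly f U * ord_poly c.
have goodD r s : good r -> good s -> good (r + s).
  by move=> [U hU] [V hV]; exists (U + V); rewrite rmorphD !mulrDl hU hV.
have goodM (u : {poly T}) r : good r -> good (map_poly f u * r).
  by move=> [U hU]; exists (u * U); rewrite rmorphM -!mulrA hU.
have good0 : good 0 by exists 0; rewrite rmorph0 !mul0r.
have gooddn j : (j <= d)%N -> good (ord_poly c)^`(j).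
  (* [logderE] gives the exponent j; the factor P^(d-j) raises it to d. *)
  move=> le; exists (logder P Q j * P ^+ (d - j)).
  rewrite rmorphM rmorphXn /= map_logder fP fQ mulrAC logderE; last by ring.
  rewrite -mulrA -exprD.
  by rewrite subnKC.
suff H s (i : 'I_d.+1) : (d - i < s)%N -> good (c i)%:P.
  by move=> i; case: (H (d - i).+1 i (leqnn _)) => U hU; exists U; rewrite -mul_polyC.
elim: s i => // s IH i lts.
have : good ((c i)%:P *+ i`!).
  have -> : (c i)%:P *+ i`! = (ord_poly c)^`(i) -
      \sum_(j < d.+1 | j != i) (c j *: 'X^(j - i)) *+ j ^_ i.
    by rewrite derivn_ord_poly (bigD1 i) //= addrK subnn expr0 ffactnn alg_polyC.
  apply: (goodD); first by apply: gooddn; rewrite -ltnS.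
  rewrite -sumrN; elim/big_ind: _ => [//|r t|j ne]; first exact: goodD.
  (* Terms with j < i vanish; for j > i the coefficient is good by induction, as d - j < d - i. *)
  have [lt|ge] := ltnP j i; first by rewrite ffact_small // mulr0n oppr0.
  have -> : - ((c j *: 'X^(j - i)) *+ j ^_ i) =
     map_poly f (- 'X^(j - i) *+ j ^_ i) * (c j)%:P.
    rewrite rmorphMn rmorphN /= map_polyXn -mul_polyC; ring.
  apply/goodM/IH; move: ge ne (ltn_ord j) lts; rewrite -val_eqE /=; lia.
(* The factorial is inverted in T, so that the cofactor stays in the image of f. *)
move=> /(goodM ((i`!%:R)^-1)%:P).
rewrite map_polyC /=; set u := f _.
have -> : u%:P * ((c i)%:P *+ i`!) = (u * i`!%:R * c i)%:P by rewrite !polyCM polyC_natr; ring.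
have -> : u * i`!%:R = 1.
  by rewrite -(rmorph_nat f) -rmorphM mulVr ?rmorph1 // natu ?fact_gt0.
by rewrite mul1r.
Qed.

(** * Polynomials with coefficients in a prime ideal *)

Section PolyPrime.
Variables (R : comNzRingType) (p : {pred R}).
Hypotheses (pI : idealr_closed p) (pP : prime_idealr_closed p).

Lemma mem_ideal0 : 0 \in p. Proof. by case: pI. Qed.
Lemma mem_idealD x y : x \in p -> y \in p -> x + y \in p.
Proof. by case: pI => _ _ h hx; rewrite -[x]mul1r; apply: h. Qed.
Lemma mem_idealMl x y : y \in p -> x * y \in p.
Proof. by case: pI => h0 _ h hy; rewrite -[_ * _]addr0; apply: h. Qed.
Lemma mem_idealMr x y : x \in p -> x * y \in p.
Proof. by rewrite mulrC; apply: mem_idealMl. Qed.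
Lemma mem_idealN x : x \in p -> - x \in p.
Proof. by rewrite -mulN1r; apply: mem_idealMl. Qed.
Lemma mem_ideal_sum (I : Type) (s : seq I) (Q : pred I) F :
  (forall i, Q i -> F i \in p) -> \sum_(i <- s | Q i) F i \in p.
Proof. move=> h; elim/big_ind: _ => //; [exact: mem_ideal0|exact: mem_idealD]. Qed.
Lemma mem_ideal_exp x j : x ^+ j \in p -> x \in p.
Proof.
elim: j => [|j IH]; first by case: pI => _ /negPf ->.
by rewrite exprS => /pP /orP[].
Qed.

(** This is membership in the extended ideal pR[X]. *)
Definition coefs_in (f : {poly R}) : Prop := forall i, f`_i \in p.

Lemma coefs_inD f g : coefs_in f -> coefs_in g -> coefs_in (f + g).
Proof. by move=> hf hg i; rewrite coefD mem_idealD. Qed.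
Lemma coefs_inM f g : coefs_in g -> coefs_in (f * g).
Proof. by move=> hg i; rewrite coefM; apply: mem_ideal_sum => j _; apply: mem_idealMl. Qed.
Lemma coefs_in_pow f e : (0 < e)%N -> coefs_in f -> coefs_in (f ^+ e).
Proof. by case: e => // e _ hf; rewrite exprSr; apply: coefs_inM. Qed.
Lemma coefs_in_deriv f : coefs_in f -> coefs_in f^`().
Proof. by move=> hf i; rewrite coef_deriv -mulr_natl; apply: mem_idealMl. Qed.

(** Gauss's lemma: if i and j are the least indices of coefficients outside p, the coefficient of fg
    at i + j is f_i g_j modulo p. *)
Lemma coefs_in_prime f g : coefs_in (f * g) -> coefs_in f \/ coefs_in g.
Proof.
move=> h; apply: contrapT => /not_orP[/existsNP[i0 /negP hi] /existsNP[j0 /negP hj]].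
case: (ex_minnP (ex_intro (fun i => f`_i \notin p) i0 hi)) => i {}hi mini.
case: (ex_minnP (ex_intro (fun i => g`_i \notin p) j0 hj)) => j {}hj minj.
have := h (i + j)%N; rewrite coefM.
have lt : (i < (i + j).+1)%N by rewrite ltnS leq_addr.
rewrite (bigD1 (Ordinal lt)) //= addKn => hh.
have hs : \sum_(l < (i + j).+1 | l != Ordinal lt) f`_l * g`_(i + j - l) \in p.
  apply: mem_ideal_sum => l; rewrite -val_eqE /= => ne.
  have [lti|gei] := ltnP l i.
    by apply: mem_idealMr; apply: contraLR lti => /mini; rewrite -leqNgt.
  have ltj : (i + j - l < j)%N by move: ne (ltn_ord l); lia.
  by apply: mem_idealMl; apply: contraLR ltj => /minj; rewrite -leqNgt.
have := mem_idealD hh (mem_idealN hs); rewrite addrK => /pP.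
by rewrite (negPf hi) (negPf hj).
Qed.

Lemma coefs_in_exp f j : coefs_in (f ^+ j) -> coefs_in f.
Proof.
elim: j => [|j IH]; last by rewrite exprS => /coefs_in_prime[].
move/(_ 0%N); rewrite expr0 coef1 eqxx => h1.
by case: pI => _ /negP [].
Qed.

(** Modulo P and P' the recursion reduces to R_(j+1) = Q R_j. *)
Lemma logder_coefs_in P Q j : coefs_in P -> coefs_in (logder P Q j - Q ^+ j).
Proof.
move=> hP; elim: j => [|j IH]; first by rewrite subrr => i; rewrite coef0 mem_ideal0.
have -> : logder P Q j.+1 - Q ^+ j.+1 = Q * (logder P Q j - Q ^+ j)
   + ((logder P Q j)^`() * P + (- (logder P Q j) *+ j) * P^`()).
  by rewrite /= exprS; ring.
apply: coefs_inD; first exact: coefs_inM.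
by apply: coefs_inD; apply: coefs_inM => //; apply: coefs_in_deriv.
Qed.

End PolyPrime.

(** * Multidegrees and homogeneous components *)

Lemma ord2_cases (j : 'I_2) : j = 0 \/ j = 1.
Proof. by case: j => [[|[|//]] h]; [left|right]; apply: val_inj. Qed.

Lemma big_ord2 (R : Type) (idx : R) (op : Monoid.law idx) (z : 'I_2 -> R) :
  \big[op/idx]_(j < 2) z j = op (z 0) (z 1).
Proof. by rewrite big_ord_recl big_ord1; congr (op _ (z _)); apply: val_inj. Qed.

Section Multigraded.
Variables (k : fieldType) (N r : nat) (g : 'I_N -> 'I_r).

Lemma gdegU j v : gdeg g j U_(v)%MM = (g v == j).
Proof.
rewrite /gdeg big_mkcond (bigD1 v) //= mnm1E eqxx big1 ?addn0; first by case: ifP.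
by move=> b ne; rewrite mnm1E [v == b]eq_sym (negPf ne) if_same.
Qed.

Lemma gdeg_ge (mu : 'X_{1..N}) v : (mu v <= gdeg g (g v) mu)%N.
Proof. by rewrite /gdeg (bigD1 v) //= leq_addr. Qed.

Lemma gdeg_gt0 j (mu : 'X_{1..N}) : (0 < gdeg g j mu)%N -> exists2 v, g v = j & mu v != 0%N.
Proof.
rewrite lt0n sum_nat_eq0 => /forallPn /= [v]; rewrite negb_imply => /andP[/eqP gv nz].
by exists v.
Qed.

Lemma multihomogM d e (F G : {mpoly k[N]}) : multihomog g d F -> multihomog g e G ->
  multihomog g (fun j => d j + e j)%N (F * G).
Proof. by move=> hF hG j; apply: dhomogM. Qed.

Lemma multihomogXn d e (F : {mpoly k[N]}) : multihomog g d F ->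
  multihomog g (fun j => d j * e)%N (F ^+ e).
Proof. by move=> hF j; apply: dhomogMn. Qed.

Lemma multihomogU v : multihomog g (fun j => (g v == j) : nat) ('X_v : {mpoly k[N]}).
Proof. by move=> j; rewrite dhomogX /= gdegU. Qed.

Lemma pihomog_homog (mf mf' : measure N) d e (F : {mpoly k[N]}) :
  F \is d.-homog for mf -> pihomog mf' e F \is d.-homog for mf.
Proof.
move=> /dhomogP hF; rewrite pihomogE big_seq_cond; apply: rpred_sum => mu /andP[hm _].
by rewrite rpredZ // dhomogX; apply/eqP/hF.
Qed.

(** Rescaling each group of variables by its own factor acts on a monomial through its
    multidegree. *)
Lemma prod_gdeg (R : comNzRingType) (x : 'I_N -> R) (z : 'I_r -> R) (mu : 'X_{1..N}) :
  \prod_v (x v * z (g v)) ^+ mu v =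
  (\prod_v x v ^+ mu v) * \prod_j z j ^+ gdeg g j mu.
Proof.
under eq_bigr => v _ do rewrite exprMn; rewrite big_split /=; congr (_ * _).
rewrite (partition_big g predT) //=; apply: eq_bigr => j _.
by rewrite /gdeg -prodrXr; apply: eq_bigr => v /eqP ->.
Qed.

Lemma pihomogC (mf mf' : measure N) d e (F : {mpoly k[N]}) :
  pihomog mf d (pihomog mf' e F) = pihomog mf' e (pihomog mf d F).
Proof.
rewrite [F]mpolyE (linear_sum (pihomog mf' e)) !(linear_sum (pihomog mf d)).
rewrite (linear_sum (pihomog mf' e)) /=.
apply: eq_bigr => mu _; rewrite !linearZ /= !pihomogX; congr (_ *: _).
by case: ifP => h1; case: ifP => h2; rewrite ?raddf0 ?pihomogX ?h1 ?h2.
Qed.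

Lemma mproj_eq (p q : mproj k g) : (forall F, (F \in p) = (F \in q)) -> p = q.
Proof.
move=> pq.
have : mproj_ideal p = mproj_ideal q by apply/funext => F; apply: pq.
case: p q {pq} => p1 p2 p3 p4 p5 [q1 q2 q3 q4 q5] /= e; subst q1.
by congr MProj; apply: Prop_irrelevance.
Qed.

End Multigraded.

HB.instance Definition _ (k : fieldType) (N r : nat) (g : 'I_N -> 'I_r) (M : nat)
  (f : morphism k g M) := GRing.RMorphism.copy (pullback f) (comp_mpoly f).

(** * The comorphism of sigma on coordinates *)

Section Sigma.
Variables (k : fieldType) (m n : nat).
Hypotheses (char0 : [pchar k] =i pred0) (hm : (1 <= m)%N) (hn : (1 <= n)%N).

Local Notation S := {mpoly k[m.+1 + n.+1]}.
Local Notation T := {mpoly k[(m + n).+1 + (m + n - 2).+1]}.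
Local Notation phi := (pullback (sigma k m n)).
Local Notation h1 e F := (multihomog (@onegroup ((m + n).+1 + (m + n - 2).+1)) (fun=> e) F).
Local Notation h2 d F := (multihomog (@two_groups m n) d F).

Definition Acoef (i : 'I_m.+1) : S := 'X_(lshift n.+1 i).
Definition Bcoef (j : 'I_n.+1) : S := 'X_(rshift m.+1 j).
Definition Apoly := ord_poly Acoef.
Definition Bpoly := ord_poly Bcoef.
(** With [Wtrans], the two components of the generic point of W, dehomogenized. *)
Definition Wprod : {poly T} := ord_poly (fun l : 'I_(m + n).+1 => 'X_(lshift _ l)).
Definition Wtrans : {poly T} := ord_poly (fun l : 'I_(m + n - 2).+1 => 'X_(rshift _ l)).

Lemma natk_neq0 i : (0 < i)%N -> i%:R != 0 :> k.
Proof. by move=> i0; rewrite ((pcharf0P _).1 char0) -lt0n. Qed.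

Lemma phiXU v : phi 'X_v = sigma_form k v.
Proof. by rewrite /pullback comp_mpolyXU -tnth_nth tnth_mktuple. Qed.

Lemma coef_sum2 (F : 'I_m.+1 -> 'I_n.+1 -> S) (e : 'I_m.+1 -> 'I_n.+1 -> nat) l :
  (\sum_(i < m.+1) \sum_(j < n.+1) F i j *: 'X^(e i j))`_l =
  \sum_(i < m.+1) \sum_(j < n.+1) (e i j == l)%:R * F i j.
Proof.
rewrite coef_sum; apply: eq_bigr => i _; rewrite coef_sum; apply: eq_bigr => j _.
by rewrite coefZ coefXn eq_sym mulrC.
Qed.

Lemma phi_Wprod : map_poly phi Wprod = Apoly * Bpoly.
Proof.
rewrite ord_poly_map ord_polyM; apply/polyP => l; rewrite coef_sum2.
have [lt|ge] := ltnP l (m + n).+1.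
  rewrite (coef_ord_poly _ (Ordinal lt)) /= phiXU /sigma_form (unsplitK (inl _)).
  exact: mcoeff_bformM.
rewrite coef_ord_poly_gt // big1 // => i _; rewrite big1 // => j _.
case: eqP => [e|]; last by rewrite mul0r.
by move: ge; rewrite -e; have := ltn_ord i; have := ltn_ord j; lia.
Qed.

Lemma bmon_coef0 d i : bmon d i 0 = (d - i)%N.
Proof. by rewrite /bmon mnmDE !mulmnE !mnm1E eqxx /= mul1n mul0n addn0. Qed.

Lemma bmon_coef1 d i : bmon d i 1 = i.
Proof. by rewrite /bmon mnmDE !mulmnE !mnm1E eqxx /= mul1n mul0n. Qed.

Lemma mnm2P (x y : 'X_{1..2}) : x 0 = y 0 -> x 1 = y 1 -> x = y.
Proof.
move=> h0 h1; apply/mnmP => i.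
by have [->|->] := ord2_cases i.
Qed.

(** The two products in [tcoef] combine to (m - i) j - i (n - j) = m j - n i. *)
Lemma tcoef_bmon (i : 'I_m.+1) (j : 'I_n.+1) l : (l <= m + n - 2)%N ->
  tcoef S m n i j (bmon (m + n - 2) l) =
  ((i + j).-1 == l)%:R * (m%:R * j%:R - n%:R * i%:R).
Proof.
move=> hl; rewrite /tcoef !bmon_coef0 !bmon_coef1.
have im := ltn_ord i; have jn := ltn_ord j.
(* A nonzero factor ensures that no exponent truncates under subtraction. *)
have mon01 : ((m - i) * j != 0)%N ->
    (bmon m i - U_(0%R : 'I_2) + (bmon n j - U_(1%R : 'I_2)))%MM = bmon (m + n - 2) (i + j).-1.
  by move=> nz; apply: mnm2P; rewrite mnmDE !mnmBE !mnm1E !(bmon_coef1, bmon_coef0) /=; nia.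
have mon10 : (i * (n - j) != 0)%N ->
    (bmon m i - U_(1%R : 'I_2) + (bmon n j - U_(0%R : 'I_2)))%MM = bmon (m + n - 2) (i + j).-1.
  by move=> nz; apply: mnm2P; rewrite mnmDE !mnmBE !mnm1E !(bmon_coef1, bmon_coef0) /=; nia.
have -> : ((m - i) * j * ((bmon m i - U_(0%R : 'I_2) + (bmon n j - U_(1%R : 'I_2)))%MM
      == bmon (m + n - 2) l) =
    (m - i) * j * ((i + j).-1 == l))%N.
  have [->//|/mon01->] := eqVneq ((m - i) * j)%N 0%N.
  by rewrite (inj_eq (@bmon_inj _)).
have -> : (i * (n - j) * ((bmon m i - U_(1%R : 'I_2) + (bmon n j - U_(0%R : 'I_2)))%MM
      == bmon (m + n - 2) l) =
    i * (n - j) * ((i + j).-1 == l))%N.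
  have [->//|/mon10->] := eqVneq (i * (n - j))%N 0%N.
  by rewrite (inj_eq (@bmon_inj _)).
by rewrite !natrM !natrB; [ring|lia|lia].
Qed.

(** By Euler's relation the x_1-derivatives of A and B dehomogenize to m a - x a' and n b - x b';
    the terms x a' b' cancel in the transvectant. *)
Lemma phi_Wtrans :
  (m * n)%:R * map_poly phi Wtrans =
  m%:R * (Apoly * Bpoly^`()) - n%:R * (Apoly^`() * Bpoly).
Proof.
rewrite ord_poly_map ord_poly_derivM ord_polyM_deriv -!polyC_natr; apply/polyP => l.
rewrite coefB !coefCM !coef_sum2.
rewrite !mulr_sumr -sumrB.
have [lt|ge] := ltnP l (m + n - 2).+1.
  rewrite (coef_ord_poly _ (Ordinal lt)) /= phiXU /sigma_form (unsplitK (inr _)).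
  rewrite mcoeff_transvectant1 mulrA divrr ?mul1r; last first.
    rewrite -(rmorph_nat (@mpolyC _ k)) rmorph_unit // unitfE natk_neq0 // muln_gt0.
    by rewrite hm.
  apply: eq_bigr => i _; rewrite !mulr_sumr -sumrB; apply: eq_bigr => j _.
  rewrite tcoef_bmon // -/(Acoef i) -/(Bcoef j).
  by move: (_ == _)%:R (Acoef i) (Bcoef j) => c x y; ring.
rewrite coef_ord_poly_gt // mulr0; symmetry; apply: big1 => i _.
rewrite !mulr_sumr -sumrB; apply: big1 => j _.
case: eqP => [e|]; last by rewrite !mul0r !mulr0 subrr.
(* Beyond order m + n - 2 only i = m, j = n remains, where m n - n m = 0. *)
have [im jn] : i = m :> nat /\ j = n :> nat.
  by move: (ltn_ord i) (ltn_ord j); lia.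
by rewrite im jn; ring.
Qed.

Lemma natT_unit i : (0 < i)%N -> i%:R \is a @GRing.unit T.
Proof.
by move=> i0; rewrite -(rmorph_nat (@mpolyC _ k)) rmorph_unit // unitfE natk_neq0.
Qed.

Lemma phi_natV i : (0 < i)%N -> phi i%:R^-1 * i%:R = 1.
Proof. by move=> i0; rewrite -(rmorph_nat phi) -rmorphM mulVr ?rmorph1 ?natT_unit. Qed.

(** Q for the factor a, solved from m (ab)' - (m a b' - n a' b) = (m + n) a' b. *)
Definition WderivA : {poly T} :=
  ((m + n)%:R^-1)%:P * (m%:R * Wprod^`() - (m * n)%:R * Wtrans).

Definition WderivB : {poly T} := Wprod^`() - WderivA.

Lemma phi_WderivA : map_poly phi WderivA = Apoly^`() * Bpoly.
Proof.
rewrite rmorphM rmorphB (rmorphM _ m%:R) (rmorphM _ (m * n)%:R) !rmorph_nat /=.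
rewrite map_polyC phi_Wtrans -deriv_map phi_Wprod /=.
set u := phi _.
have -> : u%:P * (m%:R * (Apoly * Bpoly)^`() -
    (m%:R * (Apoly * Bpoly^`()) - n%:R * (Apoly^`() * Bpoly)))
  = (u * (m + n)%:R)%:P * (Apoly^`() * Bpoly).
  by rewrite derivM polyCM polyC_natr natrD; ring.
by rewrite phi_natV ?mul1r // addn_gt0 hm.
Qed.

Lemma phi_WderivB : map_poly phi WderivB = Bpoly^`() * Apoly.
Proof. by rewrite rmorphB /= phi_WderivA -deriv_map phi_Wprod derivM; ring. Qed.

(** These serve as local denominators: multiplied by their powers, forms of bidegree (d, d) enter
    the image of [phi]. *)
Definition powcoef l : T := (Wprod ^+ (m + n))`_l.

Lemma Apoly_neq0 : Apoly != 0.
Proof.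
apply/eqP => /(congr1 (fun p : {poly S} => p`_(ord0 : 'I_m.+1))).
rewrite coef_ord_poly coef0 => /(congr1 (mcoeff U_(lshift n.+1 ord0))) /eqP.
by rewrite mcoeffX eqxx mcoeff0 oner_eq0.
Qed.

Lemma WderivA_eq : (m * n)%:R * Wtrans = m%:R * Wprod^`() - (m + n)%:R * WderivA.
Proof.
rewrite /WderivA -[(m + n)%:R]polyC_natr mulrA -polyCM divrr ?polyC1; first by ring.
by rewrite natT_unit // addn_gt0 hm.
Qed.

(** * The denominators have no common zero on the locus of the kernel *)

Section Point.
Variable y : proj k ((m + n).+1 + (m + n - 2).+1).
Hypothesis yker : forall h, phi h = 0 -> h \in y.

Let yI := mproj_idealP y.
Let yP := mproj_primeP (m := y).

(** Proved for every y containing the kernel, not only for images, since closedness of the range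
    relies on it. *)
Lemma powcoef_notin : exists l, powcoef l \notin y.
Proof.
apply: contrapT => hn'.
have /(coefs_in_exp yI yP) cP : coefs_in y (Wprod ^+ (m + n)).
  by move=> l; apply: contrapT => /negP nl; apply: hn'; exists l.
(* R_(m+1) a = a^(m+1) P^(m+1) = 0 because a has degree at most m; as a is nonzero in a domain,
   R_(m+1) pulls back to 0. *)
have cR : coefs_in y (logder Wprod WderivA m.+1).
  move=> l; apply: yker.
  suff: map_poly phi (logder Wprod WderivA m.+1) = 0.
    by move=> /(congr1 (fun p : {poly S} => p`_l)); rewrite coef_map coef0.
  rewrite map_logder phi_Wprod phi_WderivA.
  have /eqP := @logderE _ Apoly (Apoly * Bpoly) (Apoly^`() * Bpoly) m.+1 ltac:(by ring).
  rewrite derivn_poly0 ?size_ord_poly // mul0r mulf_eq0 (negPf Apoly_neq0) orbF.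
  by move=> /eqP.
(* R_(m+1) is Q^(m+1) modulo P and P', so Q vanishes at y as well. *)
have cQ : coefs_in y WderivA.
  apply: (coefs_in_exp yI yP (j := m.+1)).
  have := coefs_inD yI cR (coefs_inM yI (-1) (logder_coefs_in yI WderivA m.+1 cP)).
  by congr (coefs_in y _); ring.
(* P' and Q determine the transvectant, so all coordinates would vanish at y. *)
have cJ : coefs_in y ((m * n)%:R * Wtrans).
  rewrite WderivA_eq -mulNr; apply: coefs_inD => //; apply: coefs_inM => //.
  exact: coefs_in_deriv.
have [v _ /negP] := mproj_relevantP y ord0; apply.
rewrite -[v]splitK; case: split => l /=.
  by have := cP l; rewrite coef_ord_poly.
have := cJ l; rewrite -polyC_natr coefCM coef_ord_poly.
move/(mem_idealMl yI (m * n)%:R^-1); rewrite mulrA mulVr ?mul1r //.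
by rewrite natT_unit // muln_gt0 hm.
Qed.

End Point.

(** * Lifting bihomogeneous forms to the coordinate ring of W *)

Lemma h2_phi e h : h1 e h -> h2 (fun=> e) (phi h).
Proof.
move=> hh j; have j0 : (0 < mor_deg (sigma k m n) j)%N by [].
have := pullback_pihomog ord0 e h j0.
rewrite (pihomog_dE (hh ord0)) muln1 => ->; exact: pihomogP.
Qed.

(** The degree e component of h is still a preimage, since [phi] carries degree e to bidegree (e,
    e). *)
Lemma h1_lift e h : h2 (fun=> e) (phi h) -> exists2 h', h1 e h' & phi h' = phi h.
Proof.
move=> hh; exists (pihomog (gdeg (@onegroup _) ord0) e h).
  by move=> j; rewrite (ord1 j); apply: pihomogP.
have j0 : (0 < mor_deg (sigma k m n) (0%R : 'I_2))%N by [].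
by have := pullback_pihomog ord0 e h j0 => ->; rewrite muln1 pihomog_dE.
Qed.

Lemma Wprod_homog l : h1 1 Wprod`_l.
Proof.
move=> j; have [lt|ge] := ltnP l (m + n).+1; last by rewrite coef_ord_poly_gt // dhomog0.
by rewrite (coef_ord_poly _ (Ordinal lt)) dhomogX /= gdeg_onegroup mdeg1.
Qed.

Lemma Wprod_exp_homog e l : h1 e (Wprod ^+ e)`_l.
Proof.
move=> j; elim: e l => [|e IH] l.
  by rewrite coef1; case: eqP => _; [apply: dhomog1|apply: dhomog0].
rewrite exprS coefM; apply: rpred_sum => i _.
exact: (dhomogM (Wprod_homog i j) (IH _)).
Qed.

Lemma powcoef_homog l : h1 (m + n)%N (powcoef l).
Proof. exact: Wprod_exp_homog. Qed.

Lemma ABcoef_homog i j : h2 (fun=> 1%N) (Acoef i * Bcoef j).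
Proof. exact: bihomogXX. Qed.

(** From a_i P^m = U a and b_j P^n = V b follows a_i b_j P^(m+n) = U V P; then the coefficient at l
    is taken. *)
Lemma ABpowcoef i j l : exists2 h, h1 (m + n).+1%N h & phi h = Acoef i * Bcoef j * phi (powcoef l).
Proof.
have [U hU] := coef_pow_dvd_image natT_unit phi_Wprod phi_WderivA i.
have [V hV] := coef_pow_dvd_image natT_unit (etrans phi_Wprod (mulrC _ _)) phi_WderivB j.
have E : (Acoef i * Bcoef j) *: (Apoly * Bpoly) ^+ (m + n) = map_poly phi (U * V * Wprod).
  rewrite !rmorphM /= phi_Wprod mulrACA -hU -/Bpoly -hV.
  by rewrite [Bpoly * Apoly]mulrC -scalerAl -scalerAr scalerA exprD.
have Ep : phi (U * V * Wprod)`_l = Acoef i * Bcoef j * phi (powcoef l).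
  by rewrite -coef_map -E coefZ -phi_Wprod -rmorphXn coef_map.
rewrite -Ep; apply: h1_lift; rewrite Ep => g.
exact: (dhomogM (ABcoef_homog i j g) (h2_phi (powcoef_homog l) g)).
Qed.

Lemma two_groups0 v : two_groups (n := n) v = 0 -> exists i : 'I_m.+1, v = lshift n.+1 i.
Proof.
by rewrite -[v]splitK; case: split => i /=; [exists i|rewrite two_groups_r].
Qed.

Lemma two_groups1 v : two_groups (n := n) v = 1 -> exists j : 'I_n.+1, v = rshift m.+1 j.
Proof.
by rewrite -[v]splitK; case: split => i /=; [rewrite two_groups_l|exists i].
Qed.

(** A monomial of bidegree (d, d) splits into d factors a_i b_j, each lifted at the cost of one
    [powcoef l]. *)
Lemma monom_lift l d mu :
  gdeg (@two_groups m n) 0 mu = d -> gdeg (@two_groups m n) 1 mu = d ->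
  exists h, phi h = 'X_[mu] * phi (powcoef l) ^+ d.
Proof.
elim: d mu => [|d IH] mu d0 d1.
  exists 1; rewrite rmorph1 mulr1 (_ : mu = 0%MM) ?mpolyX0 //.
  apply/mnmP => v; rewrite mnm0E; apply/eqP; rewrite -leqn0.
  have := gdeg_ge (@two_groups m n) mu v.
  by have [->|->] := ord2_cases (two_groups v); rewrite ?d0 ?d1.
have [v /two_groups0 [i ->] nz] : exists2 v, two_groups (n := n) v = 0 & mu v != 0%N.
  by apply: gdeg_gt0; rewrite d0.
have [w /two_groups1 [j ->] nz'] : exists2 v, two_groups (n := n) v = 1 & mu v != 0%N.
  by apply: gdeg_gt0; rewrite d1.
pose mu1 := (mu - U_(lshift n.+1 i))%MM; pose mu2 := (mu1 - U_(rshift m.+1 j))%MM.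
have e1 : mu = (mu1 + U_(lshift n.+1 i))%MM by rewrite submK // lep1mP.
have e2 : mu1 = (mu2 + U_(rshift m.+1 j))%MM.
  by rewrite submK // lep1mP mnmBE mnm1E eq_lrshift subn0.
have [h hh] : exists h, phi h = 'X_[mu2] * phi (powcoef l) ^+ d.
  apply: IH; [move: d0|move: d1]; rewrite e1 e2 !gdegD !gdegU;
  rewrite two_groups_l two_groups_r ?eqxx ?addn0 ?addn1 => -[<-] //.
have [h' _ hh'] := ABpowcoef i j l.
exists (h * h'); rewrite rmorphM /= hh hh' e1 e2 !mpolyXD exprSr.
by rewrite /Acoef /Bcoef; ring.
Qed.

Lemma diag_lift l d F : h2 (fun=> d) F ->
  exists2 h, h1 (d + (m + n) * d)%N h & phi h = F * phi (powcoef l) ^+ d.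
Proof.
move=> hF.
suff [h hh] : exists h, phi h = F * phi (powcoef l) ^+ d.
  rewrite -hh; apply: h1_lift; rewrite hh.
  exact: (multihomogM hF (multihomogXn d (h2_phi (powcoef_homog l)))).
rewrite [F]mpolyE big_seq.
pose good G := exists h, phi h = G * phi (powcoef l) ^+ d.
have : good (\sum_(mu <- msupp F | mu \in msupp F) F@_mu *: 'X_[mu]); last by [].
elim/big_ind: _ => [|G H [h hh] [h' hh']|mu hmu].
- by exists 0; rewrite rmorph0 mul0r.
- by exists (h + h'); rewrite rmorphD mulrDl /= hh hh'.
have [h hh] := monom_lift l (dhomog_mf (hF 0) hmu) (dhomog_mf (hF 1) hmu).
by exists (F@_mu *: h); rewrite /pullback comp_mpolyZ -/(phi h) hh scalerAl.
Qed.

(** Powers of coordinates nonzero at q balance the bidegree to (e, e) before [diag_lift]. Since c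
    and the degree depend only on q and d, numerator and denominator of a fraction can be lifted
    together. *)
Lemma local_lift (q : mproj k (@two_groups m n)) d :
  exists2 c, c \notin q &
  exists e, forall F, h2 d F -> exists2 h, h1 e h & phi h = F * c.
Proof.
have qI := mproj_idealP q; have qP := mproj_primeP (m := q).
have [l hl] : exists l, powcoef l \notin mor_point (sigma k m n) q.
  by apply: powcoef_notin => h h0; rewrite inE h0 (mem_ideal0 qI).
have [v gv hv] := mproj_relevantP q 0; have [w gw hw] := mproj_relevantP q 1.
pose e := (d 0%R + d 1%R)%N.
exists ('X_v ^+ d 1 * 'X_w ^+ d 0 * phi (powcoef l) ^+ e).
  apply/negP => /qP /orP[/qP /orP[]|] /(mem_ideal_exp qI qP); exact/negP.
exists (e + (m + n) * e)%N => F hF.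
rewrite mulrA; apply: diag_lift => j.
have := multihomogM hF (multihomogM (multihomogXn (d 1) (@multihomogU k _ _ (@two_groups m n) v))
  (multihomogXn (d 0) (multihomogU k (@two_groups m n) w))) j.
rewrite gv gw; have [->|->] := ord2_cases j; rewrite /= ?mul1n ?mul0n ?addn0 ?add0n //.
by rewrite /e [(d 0%R + d 1%R)%N]addnC.
Qed.

(** The ideal of a point contains the bihomogeneous components of its elements. *)
Lemma bihomog_sub (p q : mproj k (@two_groups m n)) :
  (forall d F, h2 d F -> F \in p -> F \in q) -> forall F, F \in p -> F \in q.
Proof.
move=> pq F hF; have qI := mproj_idealP q.
rewrite [F](pihomog_partitionE (mf := gdeg (@two_groups m n) 0) (leqnn (mmeasure _ F))).
apply: mem_ideal_sum => // d0 _.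
set G := pihomog _ _ _.
rewrite [G](pihomog_partitionE (mf := gdeg (@two_groups m n) 1) (leqnn (mmeasure _ G))).
apply: mem_ideal_sum => // d1 _.
apply: (pq (fun j => if j == 0 then d0 : nat else d1)); last by do 2!apply: mproj_homogP.
move=> j; have [->|->] := ord2_cases j; last exact: pihomogP.
exact/pihomog_homog/pihomogP.
Qed.

(** * Injectivity, topology and sections *)

Local Notation mor := (mor_point (sigma k m n)).

Lemma mem_mor h (p : mproj k (@two_groups m n)) : (h \in mor p) = (phi h \in p).
Proof. by []. Qed.

Lemma sigma_injective : injective mor.
Proof.
suff H p q : mor p = mor q -> forall F, F \in p -> F \in q.
  by move=> p q e; apply: mproj_eq => F; apply/idP/idP; apply: H.
move=> e; apply: bihomog_sub => d F hF Fp.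
have [c hc [e' /(_ F hF) [h _ hh]]] := local_lift q d.
have : h \in mor p by rewrite mem_mor hh; exact (mem_idealMr (mproj_idealP p) c Fp).
by rewrite e mem_mor hh => /(mproj_primeP (m := q)); rewrite (negPf hc) orbF.
Qed.

Lemma sigma_continuous : continuous mor.
Proof.
apply/continuousP => _ [E hE ->].
exists [set phi h | h in E].
  by move=> _ [h /hE [d hd] <-]; exists (fun=> d 0); apply: h2_phi => j; rewrite (ord1 j).
apply/seteqP; split => p /= H H'; apply: H => F.
  by move=> EF; apply: H'; exists F.
by case=> h Eh <-; apply: H'.
Qed.

Lemma sigma_openE (U : set (mproj k (@two_groups m n))) :
  open U -> exists2 V : set (proj k _), open V & (mor @^-1` V = U)%classic.
Proof.
move=> [E hE ->].
(* Forms on W that pull back to multiples of members of E; [local_lift] supplies enough of them. *)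
pose E' := [set h | (exists e, h1 e h) /\ exists F c, E F /\ phi h = F * c].
exists (~` zero_locus E')%classic.
  by exists E' => // h [[e he] _]; exists (fun=> e).
apply/seteqP; split => q /= H H'; apply: H.
  move=> h [_ [F [c [EF hh]]]]; rewrite mem_mor hh.
  exact (mem_idealMr (mproj_idealP q) c (H' F EF)).
move=> F EF; have [d hd] := hE F EF.
have [c hc [e /(_ F hd) [h he hh]]] := local_lift q d.
have : h \in mor q by apply: H'; split; [exists e|exists F, c].
by rewrite mem_mor hh => /(mproj_primeP (m := q)); rewrite (negPf hc) orbF.
Qed.

Lemma sigma_sheaf (V : set (proj k _)) t : open V ->
  regular (@two_groups m n) (mor @^-1` V)%classic t ->
  closed (range mor) ->
  forall y : proj k _, V y -> exists W : set (proj k _),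
    [/\ open W, W y, (W `<=` V)%classic
      & exists2 s, regular (@onegroup _) W s & comorphism (sigma k m n) W s t].
Proof.
move=> oV rt cR y Vy; have [[p _ py]|ny] := pselect (range mor y); last first.
  (* Off the closed range the zero section works: no point maps there, so the comorphism condition
     is vacuous. *)
  exists (V `&` ~` range mor)%classic; split.
  - by apply: openI => //; apply: closed_openC.
  - by [].
  - by move=> ? [].
  exists (fun=> Defs.frac (0 : T) 1).
    move=> q Wq; exists (V `&` ~` range mor)%classic; split => //.
      by apply: openI => //; apply: closed_openC.
    exists (fun=> 0%N), 0, 1; split; [move=> j; exact: dhomog0|move=> j; exact: dhomog1|].
    by move=> q' _; split => //; case: (mproj_idealP q').
  by move=> q [_ []]; exists q.
rewrite -py in Vy *.
have [U [oU Up UV [d [F [G [hF hG FG]]]]]] := rt p Vy.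
have [V' oV' V'U] := sigma_openE oU.
have [c hc [e lift]] := local_lift p d.
(* Both lifts carry the same factor c, which cancels in the fraction. *)
have [hf hfe hfF] := lift F hF; have [hg hge hgG] := lift G hG.
have qM (q : mproj k (@two_groups m n)) := mproj_primeP (m := q).
(* Shrunk so that the preimage lies in U and the new denominator is nonzero. *)
pose W := (V `&` (V' `&` ~` zero_locus [set hg]))%classic.
have oW : open W.
  apply: openI => //; apply: openI => //; exists [set hg] => // _ ->; by exists (fun=> e).
have Wg q : W q -> hg \notin q.
  by move=> [_ [_ H]]; apply/negP => H'; apply: H => _ ->.
exists W; split; [by []| |by move=> ? []|].
  split => //; split; first by rewrite -[V' _]/((mor @^-1` V')%classic p) V'U.
  move=> /(_ hg erefl); rewrite mem_mor hgG => /qM; rewrite (negPf hc) orbF.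
  by apply/negP; case: (FG p Up).
exists (fun=> Defs.frac hf hg).
  move=> q Wq; exists W; split => //.
  by exists (fun=> e), hf, hg; split => // q' /Wg.
move=> q Wq; exists (fun=> e), hf, hg; split => //; first exact: Wg.
have Uq : U q by rewrite -V'U; case: Wq => _ [].
have [_ ->] := FG q Uq; rewrite hfF hgG /Defs.frac.
have c0 : @FracField.tofrac _ c != 0.
  rewrite tofrac_eq0; apply: contraNneq hc => ->; exact/mem_ideal0/mproj_idealP.
by rewrite !rmorphM /= -mulf_div divff // mulr1.
Qed.

(** * Closedness of the image: the preimage of a point *)

Section ClosedRange.
Variable y : proj k ((m + n).+1 + (m + n - 2).+1).
Hypothesis yker : forall h, phi h = 0 -> h \in y.
Variable l : nat.
Hypothesis powcoef_y : powcoef l \notin y.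

Let yI := mproj_idealP y.
Let yP := mproj_primeP (m := y).

Lemma eq_mod_ker h h' : phi h = phi h' -> h \in y -> h' \in y.
Proof.
move=> e hy; have := mem_idealD yI (yker (h := h' - h) _) hy; rewrite subrK; apply.
by rewrite rmorphB /= e subrr.
Qed.

Definition liftAB i j : T := s2val (cid2 (ABpowcoef i j l)).

Lemma liftAB_homog i j : h1 (m + n).+1%N (liftAB i j).
Proof. by rewrite /liftAB; case: cid2. Qed.

Lemma phi_liftAB i j : phi (liftAB i j) = Acoef i * Bcoef j * phi (powcoef l).
Proof. by rewrite /liftAB; case: cid2. Qed.

(** Sums of these lifts are, modulo the kernel, the coefficients of P times [powcoef l]; if all lay
    in y, so would P and hence [powcoef l]. *)
Lemma liftAB_notin : exists i j, liftAB i j \notin y.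
Proof.
apply: contrapT => H; move/negP: powcoef_y; apply.
have AB i j : liftAB i j \in y.
  by apply: contrapT => /negP h; apply: H; exists i, j.
have cP : coefs_in y Wprod.
  move=> e.
  suff /yP/orP[//|] : Wprod`_e * powcoef l \in y by rewrite (negPf powcoef_y).
  apply: (@eq_mod_ker (\sum_(i < m.+1) \sum_(j < n.+1) ((i + j)%N == e)%:R * liftAB i j)).
    rewrite rmorphM -coef_map phi_Wprod ord_polyM coef_sum2 rmorph_sum mulr_suml.
    apply: eq_bigr => i _; rewrite rmorph_sum mulr_suml; apply: eq_bigr => j _ /=.
    by rewrite rmorphM rmorph_nat /= phi_liftAB mulrA.
  by apply: mem_ideal_sum => // i _; apply: mem_ideal_sum => // j _; apply: mem_idealMl.
have mn0 : (0 < m + n)%N by rewrite addn_gt0 hm.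
exact: (coefs_in_pow yI mn0 cP).
Qed.

Variables (i0 : 'I_m.+1) (j0 : 'I_n.+1).
Hypothesis lift0 : liftAB i0 j0 \notin y.

(* Up to units these are the coordinates of the preimage of y; the extra variable
   of cone keeps track of the degree in the first group of variables. *)
Definition cone_coord (v : 'I_(m.+1 + n.+1)) : T :=
  match split v with inl i => liftAB i j0 | inr j => liftAB i0 j end.

Definition cone0 : S -> T := comp_mpoly [tuple cone_coord v | v < m.+1 + n.+1].
HB.instance Definition _ := GRing.RMorphism.on cone0.
HB.instance Definition _ := GRing.Linear.on cone0.

Definition cone : S -> {poly T} :=
  mmap (polyC \o @mpolyC _ k) (fun v => (cone_coord v)%:P * (if two_groups v == 0 then 'X else 1)).
HB.instance Definition _ := GRing.RMorphism.on cone.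

Lemma cone0X mu : cone0 'X_[mu] = \prod_v cone_coord v ^+ mu v.
Proof. by rewrite /cone0 comp_mpolyX; apply: eq_bigr => v _; rewrite tnth_mktuple. Qed.

(** Only variables of the first group carry a factor ['X], so its exponent records their degree. *)
Lemma coneE F d : (cone F)`_d = cone0 (pihomog (gdeg (@two_groups m n) 0) d F).
Proof.
rewrite [F]mpolyE (linear_sum (pihomog (gdeg (@two_groups m n) 0) d)) !rmorph_sum coef_sum.
apply: eq_bigr => mu _ /=; rewrite linearZ /= pihomogX.
rewrite /cone mmapZ /= coefCM mmapX /mmap1.
rewrite (prod_gdeg (@two_groups m n) (fun v => (cone_coord v)%:P)
  (fun j : 'I_2 => if j == 0 then 'X else 1)).
rewrite big_ord2 /= expr1n mulr1.
under eq_bigr => v _ do rewrite -polyC_exp.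
rewrite -rmorph_prod /= coefCM coefXn -cone0X eq_sym linearZ /=.
by case: eqP => _; rewrite ?mulr1 ?mulr0 ?raddf0 ?scaler0 // mul_mpolyC.
Qed.

Lemma cone_coord_homog v : h1 (m + n).+1%N (cone_coord v).
Proof. by rewrite /cone_coord; case: split => i; apply: liftAB_homog. Qed.

Lemma cone0X_homog mu : h1 ((m + n).+1 * mdeg mu)%N (cone0 'X_[mu]).
Proof.
move=> j; rewrite cone0X mdegE big_distrr /=.
elim/big_ind2: _ => [|x d1 z d2|v _]; [exact: dhomog1|exact: dhomogM|].
exact/dhomogMn/cone_coord_homog.
Qed.

Lemma mdeg_two_groups mu :
  mdeg mu = (gdeg (@two_groups m n) 0%R mu + gdeg (@two_groups m n) 1%R mu)%N.
Proof.
by rewrite mdegE (partition_big (@two_groups m n) predT) //= big_ord2.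
Qed.

(** Once the first degree is d, the second is read off from the total degree, which [cone0]
    multiplies by m + n + 1. *)
Lemma cone0_pihomog d e F : F \is d.-homog for (gdeg (@two_groups m n) 0) ->
  cone0 (pihomog (gdeg (@two_groups m n) 1) e F) =
  pihomog (gdeg (@onegroup _) ord0) ((m + n).+1 * (d + e)) (cone0 F).
Proof.
move=> /dhomogP hF; rewrite [F in LHS]mpolyE [F in RHS]mpolyE.
rewrite (linear_sum (pihomog (gdeg (@two_groups m n) 1) e)) !(linear_sum cone0).
rewrite (linear_sum (pihomog (gdeg (@onegroup _) ord0) _)) /=.
rewrite !big_seq; apply: eq_bigr => mu hmu.
rewrite !linearZ /= pihomogX; congr (_ *: _).
have hX := cone0X_homog mu ord0; have dmu := mdeg_two_groups mu.
rewrite (hF _ hmu) in dmu.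
case: eqVneq => [e1|ne]; first by rewrite -e1 -dmu (pihomog_dE hX).
by rewrite raddf0; apply/esym/(pihomog_ne0 _ hX); rewrite dmu eqn_pmul2l // eqn_add2l.
Qed.

(** Testing each coefficient in ['X], rather than [cone0 F] alone, separates the degrees in the
    first group; primality is Gauss's lemma. *)
Definition cone_ideal : {mpoly k[m.+1 + n.+1]} -> bool :=
  fun F => `[< coefs_in y (cone F) >].

Lemma cone_idealP : idealr_closed cone_ideal.
Proof.
split.
- by apply/asboolP => i; rewrite rmorph0 coef0 mem_ideal0.
- apply/asboolPn => /(_ 0%N); rewrite rmorph1 coef1; apply/negP.
  by case: yI.
move=> a u v /asboolP hu /asboolP hv; apply/asboolP.
rewrite (rmorphD cone) (rmorphM cone).
exact (coefs_inD yI (coefs_inM yI (cone a) hu) hv).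
Qed.

Lemma cone_primeP : prime_idealr_closed cone_ideal.
Proof.
move=> u v /asboolP; rewrite (rmorphM cone) => /(coefs_in_prime yI yP)[] h.
  by apply/orP; left; apply/asboolP.
by apply/orP; right; apply/asboolP.
Qed.

Lemma cone_homogP (j : 'I_2) d F :
  F \in cone_ideal -> pihomog (gdeg (@two_groups m n) j) d F \in cone_ideal.
Proof.
move=> /asboolP hF; apply/asboolP => e; rewrite coneE.
have {}hF e' := hF e'; rewrite ?coneE in hF.
have [->|->] := ord2_cases j.
  have [->|ne] := eqVneq e d; first by rewrite pihomog_id -coneE.
  rewrite (pihomog_ne0 _ (pihomogP _ _ _)) 1?eq_sym // rmorph0; exact: mem_ideal0.
rewrite pihomogC (cone0_pihomog _ (pihomogP _ _ _)).
by apply: mproj_homogP; rewrite -coneE.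
Qed.

(** The coordinates a_(i0) and b_(j0) both go to [liftAB i0 j0], up to the factor ['X]. *)
Lemma cone_relevantP (j : 'I_2) :
  exists2 v, @two_groups m n v = j & 'X_v \notin cone_ideal.
Proof.
have [->|->] := ord2_cases j.
  exists (lshift n.+1 i0); first exact: two_groups_l.
  apply/asboolPn => /(_ 1%N); rewrite /cone mmapX mmap1U two_groups_l eqxx coefMX /= coefC eqxx.
  by rewrite /cone_coord (unsplitK (inl _)); apply/negP.
exists (rshift m.+1 j0); first exact: two_groups_r.
apply/asboolPn => /(_ 0%N); rewrite /cone mmapX mmap1U two_groups_r /= mulr1 coefC eqxx.
by rewrite /cone_coord (unsplitK (inr _)); apply/negP.
Qed.

Definition cone_point : mproj k (@two_groups m n) :=
  MProj cone_idealP cone_primeP cone_homogP cone_relevantP.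

(** After [phi], each a_i is scaled by b_(j0) c and each b_j by a_(i0) c, where c is the image of
    [powcoef l]; bidegree (d, d) collects d copies of both. *)
Lemma phi_cone0 d F : h2 (fun=> d) F ->
  phi (cone0 F) = phi (liftAB i0 j0 * powcoef l) ^+ d * F.
Proof.
move=> hF; rewrite [F in RHS]mpolyE [F in LHS]mpolyE.
rewrite (linear_sum cone0) rmorph_sum mulr_sumr /= !big_seq; apply: eq_bigr => mu hmu.
rewrite linearZ /= [phi (_ *: _)]comp_mpolyZ -scalerAr -/(phi (cone0 _)); congr (_ *: _).
rewrite cone0X rmorph_prod.
pose z (j : 'I_2) := if j == 0 then Bcoef j0 * phi (powcoef l) else Acoef i0 * phi (powcoef l).
have -> : \prod_v phi (cone_coord v ^+ mu v) = \prod_v ('X_v * z (two_groups v)) ^+ mu v.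
  apply: eq_bigr => v _; rewrite rmorphXn /=; congr (_ ^+ _).
  rewrite /cone_coord -[v in RHS]splitK; case: (split v) => i /=.
    by rewrite phi_liftAB two_groups_l /z /= /Acoef mulrA.
  by rewrite phi_liftAB two_groups_r /z /= /Bcoef; ring.
rewrite prod_gdeg big_ord2 /= (dhomog_mf (hF 0) hmu).
rewrite (dhomog_mf (hF 1) hmu) -exprMn /z /= -mpolyXE_id rmorphM /= phi_liftAB mulrC.
by congr (_ ^+ _ * _); ring.
Qed.

(** On degree d forms [cone0] after [phi] is, modulo the kernel, multiplication by a power of an
    element outside y. *)
Lemma cone_pointE : mor_point (sigma k m n) cone_point = y.
Proof.
apply: mproj_eq => h; rewrite [LHS]/(`[< coefs_in y (cone (phi h)) >]).
have comp d : ((cone (phi h))`_d \in y) = (pihomog (gdeg (@onegroup _) ord0) d h \in y).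
  rewrite coneE.
  have jpos : (0 < mor_deg (sigma k m n) (0%R : 'I_2))%N by [].
  have := pullback_pihomog ord0 d h jpos; rewrite muln1 => <-.
  set hd := pihomog _ d h.
  have e1 : phi (cone0 (phi hd)) = phi ((liftAB i0 j0 * powcoef l) ^+ d * hd).
    rewrite (rmorphM phi (_ ^+ d) hd) (rmorphXn phi); apply/phi_cone0/h2_phi => j.
    by rewrite (ord1 j); apply: pihomogP.
  apply/idP/idP => [/(eq_mod_ker e1)/yP/orP[/(mem_ideal_exp yI yP)/yP|//]|hy].
    by rewrite (negPf lift0) (negPf powcoef_y).
  by apply: (eq_mod_ker (esym e1)); apply: mem_idealMl.
apply/asboolP/idP => [H|hy d]; last by rewrite comp; apply: mproj_homogP.
rewrite [h](pihomog_partitionE (mf := gdeg (@onegroup _) ord0) (leqnn (mmeasure _ h))).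
by apply: mem_ideal_sum => // d _; rewrite -comp.
Qed.

End ClosedRange.

(** The range is cut out by the homogeneous elements of the kernel of [phi]; [cone_point] gives a
    preimage of each common zero. *)
Lemma sigma_closed : closed (range mor).
Proof.
rewrite -openC.
exists [set h | phi h = 0 /\ exists d, multihomog (@onegroup _) d h]; first by move=> h [].
congr (~` _)%classic; apply/seteqP; split => y.
  by move=> [p _ <-] h [h0 _]; rewrite mem_mor h0; apply: mem_ideal0; apply: mproj_idealP.
move=> hy.
(* The components of a kernel element are in the kernel, so y contains all of it. *)
have yker h : phi h = 0 -> h \in y.
  move=> h0.
  rewrite [h](pihomog_partitionE (mf := gdeg (@onegroup _) ord0) (leqnn (mmeasure _ h))).
  apply: mem_ideal_sum => [|d _]; first exact: mproj_idealP.
  have jpos : (0 < mor_deg (sigma k m n) (0%R : 'I_2))%N by [].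
  apply: hy; split; first by rewrite (pullback_pihomog ord0 d h jpos) h0 raddf0.
  by exists (fun=> d : nat) => j; rewrite (ord1 j); apply: pihomogP.
have [l hl] := powcoef_notin yker.
have [i [j hij]] := liftAB_notin yker hl.
by exists (cone_point hij) => //; apply: cone_pointE.
Qed.

End Sigma.

Theorem theorem3p1 (k : fieldType) (char0 : [pchar k]%R =i pred0)
    (m n : nat) (hm : (1 <= m)%N) (hn : (1 <= n)%N) :
  closed_immersion (sigma k m n).
Proof.
have cl := sigma_closed char0 hm hn.
split.
- exact: sigma_injective.
- exact: sigma_continuous.
- move=> U /(sigma_openE char0 hm hn)[V oV VU]; exists V => //.
  rewrite -VU; apply/seteqP; split => [_ [p Vp <-]|_ [[p _ <-] Vp]]; last by exists p.
  by split => //; exists p.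
- by [].
move=> V t oV rt; exact: sigma_sheaf.
Qed.
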